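(* Suppose that the construction of the grids $\mathbb{Y}^{g}$, $\mathbb{V}^{g}$, $\mathbb{Z}^{g}$ requires at most $\mathcal{O}(X+U)$ operations, and that the cardinality of $\mathbb{Y}^{g}$ and $\mathbb{Z}^{g}$ (resp. of $\mathbb{V}^{g}$) in each dimension is the same as that of $\mathbb{X}^{d}$ (resp. $\mathbb{U}^{d}$) in that dimension, so that $Y=Z=X$ and $V=U$. Also assume that each evaluation of the extension operator $\widetilde{[\cdot]}$ requires $\mathcal{O}(E)$ operations. Then the time complexity of the initialization of the ConjVI algorithm is of $\mathcal{O}(X+U)$ and the time complexity of each of its iterations is of $\widetilde{\mathcal{O}}(XWE)$.
   Context: Setting. $\mathbb{X}\subset\mathbb{R}^n$ and $\mathbb{U}\subset\mathbb{R}^m$ are compact; the disturbance $w$ has finite support $\mathbb{W}^{d}\subset\mathbb{R}^n$ with probability mass function $p$; $\gamma\in(0,1)$. The dynamics is $g(x,u,w)=f_s(x)+Bu+w$ with $f_s:\mathbb{R}^n\to\mathbb{R}^n$ Lipschitz and $B\in\mathbb{R}^{n\times m}$. The stage cost is $C(x,u)=C_s(x)+C_i(u)$ with $C_s:\mathbb{X}\to\mathbb{R}$ and $C_i:\mathbb{U}\to\mathbb{R}$ Lipschitz. $\mathbb{X}^{d}\subset\mathbb{X}$ and $\mathbb{U}^{d}\subset\mathbb{U}$ are finite; for every $x\in\mathbb{X}^{d}$ there is $u\in\mathbb{U}$ with $g(x,u,w)\in\mathbb{X}$ for all $w\in\mathbb{W}^{d}$. A grid is a Cartesian product of finite subsets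 of $\mathbb{R}$; $\mathbb{Y}^{g},\mathbb{Z}^{g}\subset\mathbb{R}^n$ and $\mathbb{V}^{g}\subset\mathbb{R}^m$ are grids. $X,U,W,Y,V,Z$ are the cardinalities of $\mathbb{X}^{d},\mathbb{U}^{d},\mathbb{W}^{d},\mathbb{Y}^{g},\mathbb{V}^{g},\mathbb{Z}^{g}$. $C_s^{d},C_i^{d}$ are the restrictions of $C_s,C_i$ to $\mathbb{X}^{d},\mathbb{U}^{d}$. $\widetilde{[\cdot]}$ is an extension operator assigning to $J^{d}:\mathbb{X}^{d}\to\mathbb{R}$ a function $\widetilde{J^{d}}:\mathbb{X}\to\mathbb{R}$ (equal to $+\infty$ outside $\mathbb{X}$). For a function $h$ on a grid, $\overline{h}$ is its LERP extension (multilinear interpolation within grid cells, multilinear extrapolation outside the convex hull of the grid). ConjVI algorithm (with termination bound $e_t>0$). Initialization: (1) construct $\mathbb{V}^{g}$; (2) compute by LLT $C_i^{d*d}(v)=\max_{u\in\mathbb{U}^{d}}\{\langle u,v\rangle-C_i^{d}(u)\}$, $v\in\mathbb{V}^{g}$; (3) construct $\mathbb{Z}^{g}$; (4) construct $\mathbb{Y}^{g}$; (5) set $J^{d}(x)\leftarrow 0$ for $x\in\mathbb{X}^{d}$; (6) set $J^{d}_+(x)\leftarrow C_s^{d}(x)-\min C_i^{d}$ for $x\in\mathbb{X}^{d}$. Iteration, while $\|J_+^{d}-J^{d}\|_\infty\ge e_t$: set $J^{d}\leftarrow J_+^{d}$; compute $\varepsilon^{d}(x)=\gamma\sum_{w\in\mathbb{W}^{d}}p(w)\widetilde{J^{d}}(x+w)$,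 $x\in\mathbb{X}^{d}$; compute by LLT $\varepsilon^{d*d}(y)=\max_{x\in\mathbb{X}^{d}}\{\langle x,y\rangle-\varepsilon^{d}(x)\}$, $y\in\mathbb{Y}^{g}$; for each $y\in\mathbb{Y}^{g}$ compute $\overline{C_i^{d*d}}(-B^\top y)$ by LERP and set $\varphi^{d}(y)=\overline{C_i^{d*d}}(-B^\top y)+\varepsilon^{d*d}(y)$; compute by LLT $\varphi^{d*d}(z)=\max_{y\in\mathbb{Y}^{g}}\{\langle y,z\rangle-\varphi^{d}(y)\}$, $z\in\mathbb{Z}^{g}$; for each $x\in\mathbb{X}^{d}$ compute $\overline{\varphi^{d*d}}(f_s(x))$ by LERP and set $J_+^{d}(x)\leftarrow C_s(x)+\overline{\varphi^{d*d}}(f_s(x))$. The output is $J_+^{d}$. Cost conventions. $\mathcal{O}$ is standard big-O and $\widetilde{\mathcal{O}}$ hides logarithmic factors; dependence on the dimensions $n,m$ is ignored except in the sizes of the finite sets, and a single evaluation of an analytically available function costs $\mathcal{O}(1)$. LLT is Lucet's linear-time Legendre transform, which computes the discrete conjugate of a function given on a finite set of size $N$ on a dual grid of size $M$ in $\mathcal{O}(N+M)$ operations. One evaluation of a LERP extension from a grid of size $N$ costs $\mathcal{O}(\log N)$. *)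

(* Defs.v *)
From HB Require Import structures.
From mathcomp Require Import all_boot all_order all_algebra finmap.
From mathcomp Require Import all_classical all_reals all_analysis.

Set Implicit Arguments.
Unset Strict Implicit.
Unset Printing Implicit Defensive.

Import Order.TTheory GRing.Theory Num.Theory.
Import numFieldNormedType.Exports.

Local Open Scope classical_set_scope.
Local Open Scope ring_scope.

(* Asymptotic bounds for families of costs.  They are uniform over the whole
   index type: the constants do not depend on the index.  [isSoftO s T g] lets
   the bound [g] be multiplied by a power of the logarithm of [s]. *)

(* The bit length of [N]: log N up to constants, but positive also at N = 1. *)
Definition lg (N : nat) : nat := (trunc_log 2 N).+1.

Definition isBigO (I : Type) (T g : I -> nat) : Prop :=
  exists c : nat, forall i, (T i <= c * g i)%N.

Definition isSoftO (I : Type) (s T g : I -> nat) : Prop :=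
  exists c k : nat, forall i, (T i <= c * (g i * lg (s i) ^ k))%N.

(* A computation: its result together with the number of operations used. *)

Definition timed (A : Type) : Type := (A * nat)%type.

Definition ret (A : Type) (a : A) : timed A := (a, 0%N).

Definition tick (k : nat) : timed unit := (tt, k).

Definition bind (A B : Type) (a : timed A) (f : A -> timed B) : timed B :=
  ((f a.1).1, (a.2 + (f a.1).2)%N).

Notation "'let*' x := a 'in' b" := (bind a (fun x => b))
  (at level 200, x name, a at level 100, b at level 200).
Notation "a ';;' b" := (bind a (fun _ => b)) (at level 199, right associativity).

(* One elementary operation with result [a]. *)
Definition op1 (A : Type) (a : A) : timed A := (a, 1%N).

(* Fill a table indexed by [T]; each entry costs its own computation and one
   write. *)
Definition tabulate (T : finType) (A : Type) (F : T -> timed A) :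
    timed {ffun T -> A} :=
  ([ffun x => (F x).1], (\sum_(x : T) ((F x).2 + 1))%N).

(* Accumulate with [op] over [T]; each term costs its own computation and one
   application of [op]. *)
Definition reduce (T : finType) (A : Type) (op : A -> A -> A) (idx : A)
    (F : T -> timed A) : timed A :=
  (\big[op/idx]_(x : T) (F x).1, (\sum_(x : T) ((F x).2 + 1))%N).

Section FiniteSets.
Variables (R : realType) (d : nat).
Implicit Types (S : {fset 'cV[R]_d}) (x y : 'cV[R]_d).

Definition dotp x y : R := (x^T *m y) ord0 ord0.

Definition coords (i : 'I_d) S : {fset R} := [fset fun_of_matrix x i ord0 | x in S]%fset.

Definition is_grid S : Prop :=
  exists G : 'I_d -> {fset R},
    forall x, x \in S <-> (forall i, x i ord0 \in G i).

Definition conjugate S (h : {ffun S -> \bar R}) (y : 'cV[R]_d) : \bar R :=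
  \big[maxe/-oo%E]_(x : S) ((dotp (val x) y)%:E - h x)%E.

(* Multilinear interpolation on the grid [S].  In the direction [i], the cell
   used for the coordinate [t] is [node i t false, node i t true]: the cell
   containing [t], or the outermost one on the side of [t] when [t] lies
   outside the range of the axis, so that the same formula extrapolates.  If
   the axis has a single point then both ends coincide, and
   [slope i t = _ / 0 = 0], i.e. the interpolant is constant in direction [i]. *)

Definition axis (i : 'I_d) S : seq R := sort <=%R (coords i S).

Definition cell (i : 'I_d) S (t : R) : nat :=
  minn (count (fun a => a <= t) (axis i S)).-1 (size (axis i S)).-2.

Definition node (i : 'I_d) S (t : R) (b : bool) : R :=
  nth 0 (axis i S) (minn (cell i S t + b) (size (axis i S)).-1).

Definition slope (i : 'I_d) S (t : R) : R :=
  (t - node i S t false) / (node i S t true - node i S t false).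

(* The default value is never used by [lerp] on a nonempty grid. *)
Definition lookup S (h : {ffun S -> \bar R}) x : \bar R :=
  if insub x is Some s then h s else 0%E.

Definition lerp S (h : {ffun S -> \bar R}) x : \bar R :=
  (\sum_(b : {ffun 'I_d -> bool})
    (\prod_i (if b i then slope i S (x i ord0)
              else 1 - slope i S (x i ord0)))%:E *
    lookup h (\col_i node i S (x i ord0) (b i)))%E.

End FiniteSets.

(* The two numerical routines return the discrete conjugate and the value of
   the LERP extension; only their operation counts are left abstract. *)

Record routines (R : realType) := Routines {
  llt_cost : forall (d : nat) (S T : {fset 'cV[R]_d}),
    {ffun S -> \bar R} -> nat;
  lerp_cost : forall (d : nat) (S : {fset 'cV[R]_d}),
    {ffun S -> \bar R} -> 'cV[R]_d -> nat
}.

Definition llt (R : realType) (A : routines R) (d : nat)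
    (S T : {fset 'cV[R]_d}) (h : {ffun S -> \bar R}) :
    timed {ffun T -> \bar R} :=
  ([ffun y => conjugate h (val y)], llt_cost A T h).

Definition lerp_eval (R : realType) (A : routines R) (d : nat)
    (S : {fset 'cV[R]_d}) (h : {ffun S -> \bar R}) (x : 'cV[R]_d) :
    timed (\bar R) :=
  (lerp h x, lerp_cost A h x).

Definition llt_linear (R : realType) (A : routines R) : Prop :=
  forall d : nat, exists c : nat,
    forall (S T : {fset 'cV[R]_d}) (h : {ffun S -> \bar R}),
      is_grid T -> (llt_cost A T h <= c * (#|` S| + #|` T|))%N.

Definition lerp_logarithmic (R : realType) (A : routines R) : Prop :=
  forall d : nat, exists c : nat,
    forall (S : {fset 'cV[R]_d}) (h : {ffun S -> \bar R}) (x : 'cV[R]_d),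
      is_grid S -> (lerp_cost A h x <= c * lg #|` S|)%N.

(* The data of a run of ConjVI.  Functions on the compact sets are total
   functions; only their values on these sets matter.  The fields [*_cost] are
   the operation counts of one evaluation of the corresponding function, and of
   the construction of the corresponding grid. *)

Record problem (R : realType) (n m : nat) := Problem {
  Xset : set 'cV[R]_n;
  Uset : set 'cV[R]_m;
  Wd : {fset 'cV[R]_n};
  pmf : 'cV[R]_n -> R;
  gam : R;
  fs : 'cV[R]_n -> 'cV[R]_n;
  B : 'M[R]_(n, m);
  Cs : 'cV[R]_n -> R;
  Ci : 'cV[R]_m -> R;
  Xd : {fset 'cV[R]_n};
  Ud : {fset 'cV[R]_m};
  Yg : {fset 'cV[R]_n};
  Vg : {fset 'cV[R]_m};
  Zg : {fset 'cV[R]_n};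
  ext : {ffun Xd -> R} -> 'cV[R]_n -> \bar R;
  et : R;
  fs_cost : 'cV[R]_n -> nat;
  Cs_cost : 'cV[R]_n -> nat;
  Ci_cost : 'cV[R]_m -> nat;
  ext_cost : {ffun Xd -> R} -> 'cV[R]_n -> nat;
  Yg_cost : nat;
  Vg_cost : nat;
  Zg_cost : nat
}.

Arguments ext {R n m} p _ _.
Arguments ext_cost {R n m} p _ _.

Definition dynamics (R : realType) (n m : nat) (P : problem R n m)
    (x : 'cV[R]_n) (u : 'cV[R]_m) (w : 'cV[R]_n) : 'cV[R]_n :=
  fs P x + B P *m u + w.

Record standing (R : realType) (n m : nat) (P : problem R n m) : Prop := {
  Xset_compact : compact (Xset P);
  Uset_compact : compact (Uset P);
  pmf_gt0 : forall w, w \in Wd P -> 0 < pmf P w;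
  pmf_sum1 : \sum_(w : Wd P) pmf P (val w) = 1;
  gam_gt0 : 0 < gam P;
  gam_lt1 : gam P < 1;
  fs_lipschitz : lipschitz (fs P);
  Cs_lipschitz : [lipschitz (Cs P x : R^o) | x in Xset P];
  Ci_lipschitz : [lipschitz (Ci P u : R^o) | u in Uset P];
  Xd_sub : [set` Xd P] `<=` Xset P;
  Ud_sub : [set` Ud P] `<=` Uset P;
  Xd_neq0 : Xd P != fset0;
  Ud_neq0 : Ud P != fset0;
  Xd_feasible : forall x, x \in Xd P -> exists2 u, Uset P u &
    forall w, w \in Wd P -> Xset P (dynamics P x u w);
  Yg_grid : is_grid (Yg P);
  Vg_grid : is_grid (Vg P);
  Zg_grid : is_grid (Zg P);
  ext_fin : forall J x, Xset P x -> ext P J x \is a fin_num;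
  ext_out : forall J x, ~ Xset P x -> ext P J x = +oo%E;
  et_gt0 : 0 < et P
}.

Section ConjVI.
Variables (R : realType) (A : routines R) (n m : nat) (P : problem R n m).

(* Tables hold extended reals since [ext] takes the value +oo outside
   [Xset P].  If every [x] in [Xd P] has some [x + w] outside [Xset P], then the
   conjugates below are infinite too, and [fine] in [ext_eval] turns such
   entries into the real table expected by [ext]; it is the identity on finite
   entries. *)
Local Notation table S := ({ffun S -> \bar R}).

Definition ext_eval (J : table (Xd P)) (x : 'cV[R]_n) : timed (\bar R) :=
  let J' := [ffun a => fine (J a)] in (ext P J' x, ext_cost P J' x).

Definition Cs_eval (x : 'cV[R]_n) : timed (\bar R) := ((Cs P x)%:E, Cs_cost P x).

Definition Ci_eval (u : 'cV[R]_m) : timed (\bar R) := ((Ci P u)%:E, Ci_cost P u).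

Definition fs_eval (x : 'cV[R]_n) : timed 'cV[R]_n := (fs P x, fs_cost P x).

Definition shift (x w : 'cV[R]_n) : timed 'cV[R]_n := (x + w, n).

(* [2 * n] arithmetic operations for each of the [m] entries *)
Definition dual_input (y : 'cV[R]_n) : timed 'cV[R]_m :=
  (- ((B P)^T *m y), (m * (2 * n))%N).

(* The tables [J], [J_+] and the conjugate of [Ci]. *)
Definition initialization :
    timed ((table (Xd P) * table (Xd P)) * table (Vg P)) :=
  tick (Vg_cost P) ;;
  let* Cid := tabulate (fun u : Ud P => Ci_eval (val u)) in
  let* Cidd := llt A (Vg P) Cid in
  tick (Zg_cost P) ;;
  tick (Yg_cost P) ;;
  let* J := tabulate (fun x : Xd P => ret 0%E) in
  let* mn := reduce mine +oo%E (fun u : Ud P => ret (Cid u)) in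
  let* Jp := tabulate (fun x : Xd P =>
    let* c := Cs_eval (val x) in op1 (c - mn)%E) in
  ret ((J, Jp), Cidd).

Definition sup_dist (J Jp : table (Xd P)) : timed (\bar R) :=
  reduce maxe 0%E (fun x : Xd P =>
    let* e := op1 (Jp x - J x)%E in op1 `|e|%E).

Definition iteration_body (Cidd : table (Vg P)) (Jp : table (Xd P)) :
    timed (table (Xd P) * table (Xd P)) :=
  let* J := tabulate (fun x : Xd P => ret (Jp x)) in
  let* eps := tabulate (fun x : Xd P =>
    let* s := reduce +%E 0%E (fun w : Wd P =>
      let* z := shift (val x) (val w) in
      let* v := ext_eval J z in
      let* q := op1 (pmf P (val w)) in
      op1 (q%:E * v)%E) in
    op1 ((gam P)%:E * s)%E) in
  let* epsd := llt A (Yg P) eps in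
  let* phi := tabulate (fun y : Yg P =>
    let* v := dual_input (val y) in
    let* c := lerp_eval A Cidd v in
    op1 (c + epsd y)%E) in
  let* phid := llt A (Zg P) phi in
  let* Jp' := tabulate (fun x : Xd P =>
    let* z := fs_eval (val x) in
    let* v := lerp_eval A phid z in
    let* c := Cs_eval (val x) in
    op1 (c + v)%E) in
  ret (J, Jp').

(* One pass through the loop, including the termination test; [None] when the
   loop stops. *)
Definition iteration (Cidd : table (Vg P)) (s : table (Xd P) * table (Xd P)) :
    timed (option (table (Xd P) * table (Xd P))) :=
  let* e := sup_dist s.1 s.2 in
  let* b := op1 ((et P)%:E <= e)%E in
  if b then let* s' := iteration_body Cidd s.2 in ret (Some s') else ret None.

Definition initialization_cost : nat := initialization.2.

(* The tables at the beginning of the [t]-th iteration, if it is reached. *)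
Fixpoint trace (t : nat) : option (table (Xd P) * table (Xd P)) :=
  let: (s, Cidd) := initialization.1 in
  if t is t'.+1 then
    if trace t' is Some s' then (iteration Cidd s').1 else None
  else Some s.

Definition iteration_cost (t : nat) : nat :=
  let: (_, Cidd) := initialization.1 in
  if trace t is Some s then (iteration Cidd s).2 else 0%N.

End ConjVI.

(* Main.v *)
(* The operation count is a nested sum of unit costs over X^d, W^d, Y^g, V^g
   and Z^g.  Since the masses sum to 1, W >= 1, so with E >= 1 each of X, X * W
   and X * E is at most X * W * E; the transforms cost O(X + Y) = O(X), and the
   logarithms come only from the interpolations on V^g and Z^g, whose sizes
   U and X are at most X + U. *)
Require Import Defs.
From mathcomp Require Import all_boot all_order all_algebra finmap.
From mathcomp Require Import all_classical all_reals all_analysis.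
From mathcomp Require Import zify.

Lemma leq_lg (M N : nat) : (M <= N)%N -> (lg M <= lg N)%N.
Proof. by move=> MN; rewrite ltnS leq_trunc_log. Qed.

(** Turns the cost of a [tabulate] or [reduce] into a cardinality times a uniform cost per entry. *)
Lemma leq_sum_fset (T : choiceType) (S : {fset T}) (F : S -> nat) (k : nat) :
  (forall x, (F x <= k)%N) -> (\sum_x F x <= #|` S| * k)%N.
Proof. by move=> Fk; rewrite cardfE -sum_nat_const; apply: leq_sum. Qed.

Section Costs.
Context {R : realType} {n m : nat} {A : routines R} {P : problem R n m}.
Hypothesis hP : standing P.
Hypotheses (hY : #|` Yg P| = #|` Xd P|) (hZ : #|` Zg P| = #|` Xd P|)
           (hV : #|` Vg P| = #|` Ud P|).
Local Notation X := #|` Xd P|.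
Local Notation U := #|` Ud P|.
Local Notation W := #|` Wd P|.

Lemma Wd_card_gt0 : (0 < W)%N.
Proof.
rewrite cardfE lt0n; apply/eqP => /card0_eq W0.
have := pmf_sum1 hP; rewrite big_pred0 => [/eqP|w]; last exact: W0.
by rewrite eq_sym GRing.oner_eq0.
Qed.

Variable cC : nat.
Hypothesis Cs_le : forall x, Xset P x -> (Cs_cost P x <= cC)%N.

Lemma initialization_cost_le (cG cL : nat) :
  (forall u, Uset P u -> (Ci_cost P u <= cC)%N) ->
  (Yg_cost P + Vg_cost P + Zg_cost P <= cG * (X + U))%N ->
  (forall h : {ffun Ud P -> \bar R},
     (llt_cost A (Vg P) h <= cL * (U + #|` Vg P|))%N) ->
  (initialization_cost A P <= (cC + cG + 2 * cL + 3) * (X + U))%N.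
Proof.
move=> Ci_le grid_le llt_le.
(* The summands follow the steps of [initialization] in order, with entry costs replaced by their
   bounds; the last 0 is the final [ret]. *)
apply: (@leq_trans (Vg_cost P + (U * (cC + 1) + (cL * (U + U) +
  (Zg_cost P + (Yg_cost P + (X * 1 + (U * 1 + (X * (cC + 2) + 0))))))))%N).
  rewrite leq_add2l; apply: leq_add.
    by apply: leq_sum_fset => u; rewrite leq_add2r; apply/Ci_le/(Ud_sub hP)/valP.
  apply: leq_add; first by rewrite -[X in (_ + X)%N]hV; apply: llt_le.
  rewrite !leq_add2l; apply: leq_add; first exact: leq_sum_fset.
  apply: leq_add; first exact: leq_sum_fset.
  rewrite leq_add2r; apply: leq_sum_fset => x /=.
  by rewrite -addnA leq_add2r; apply/Cs_le/(Xd_sub hP)/valP.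
(* The 3 comes from the points of X^d: one write for [J], one subtraction and one write for
   [J_+]. *)
apply: (@leq_trans (cG * (X + U) + (cC + 2 * cL + 3) * (X + U))%N); last by lia.
apply: leq_trans (leq_add grid_le (leqnn _)); nia.
Qed.

Variables (cF cX cL cI E : nat) (Cidd : {ffun Vg P -> \bar R}).
Hypothesis E_gt0 : (0 < E)%N.
Hypothesis fs_le : forall x, (fs_cost P x <= cF)%N.
Hypothesis ext_le : forall J x, (ext_cost P J x <= cX * E)%N.
Hypothesis llt_le : forall (S T : {fset 'cV[R]_n}) (h : {ffun S -> \bar R}),
  is_grid T -> (llt_cost A T h <= cL * (#|` S| + #|` T|))%N.
Hypothesis lerpV_le : forall v, (lerp_cost A Cidd v <= cI * lg #|` Vg P|)%N.
Hypothesis lerpZ_le : forall (h : {ffun Zg P -> \bar R}) z,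
  (lerp_cost A h z <= cI * lg #|` Zg P|)%N.

(** The term [4 * cL] stands for two transforms, each between sets of size X, and [2 * cI] for the
    two interpolations; 11 absorbs the elementary operations and writes. *)
Lemma iteration_body_cost_le (Jp : {ffun Xd P -> \bar R}) :
  ((iteration_body A Cidd Jp).2 <=
   (n + cX + 4 * cL + 2 * cI + m * (2 * n) + cF + cC + 11)
     * (X * W * E * lg (X + U)))%N.
Proof.
set L := lg (X + U).
have lgV : (lg #|` Vg P| <= L)%N by rewrite hV leq_lg ?leq_addl.
have lgZ : (lg #|` Zg P| <= L)%N by rewrite hZ leq_lg ?leq_addr.
apply: (@leq_trans (X * 1 + (X * (W * (n + (cX * E + 2) + 1) + 2) +
  (cL * (X + X) + (X * (m * (2 * n) + (cI * L + 1) + 1) +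
  (cL * (X + X) + (X * (cF + (cI * L + (cC + 1)) + 1) + 0))))))%N).
  apply: leq_add; first exact: leq_sum_fset.
  apply: leq_add.
    apply: leq_sum_fset => x /=; rewrite -addnA leq_add2r.
    by apply: leq_sum_fset => w; rewrite leq_add2r leq_add2l leq_add2r.
  (* Only the second summand becomes the size of Y^g; the first is the size of the domain X^d. *)
  apply: leq_add; first by rewrite -[X in (_ + X)%N]hY; apply/llt_le/Yg_grid.
  apply: leq_add.
    rewrite -hY; apply: leq_sum_fset => y /=; rewrite leq_add2r leq_add2l leq_add2r.
    by apply: leq_trans (lerpV_le _) _; rewrite leq_mul2l lgV orbT.
  apply: leq_add.
    by rewrite -[X in (X + _)%N]hY -[X in (_ + X)%N]hZ; apply/llt_le/Zg_grid.
  rewrite leq_add2r; apply: leq_sum_fset => x /=.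
  rewrite leq_add2r; apply: leq_add; first exact: fs_le.
  apply: leq_add; last by rewrite leq_add2r; apply/Cs_le/(Xd_sub hP)/valP.
  by apply: leq_trans (lerpZ_le _ _) _; rewrite leq_mul2l lgZ orbT.
set M := (X * W * E * L)%N.
have W0 := Wd_card_gt0.
(* [lg] is a successor by definition. *)
have L0 : (0 < L)%N by [].
have XWE : (X * W * E <= M)%N by rewrite leq_pmulr.
have XW : (X * W <= M)%N by apply: leq_trans XWE; rewrite leq_pmulr.
have XL : (X * L <= M)%N by rewrite /M -!mulnA leq_mul2l mulnA leq_pmull ?orbT ?muln_gt0 ?W0.
have X1 : (X <= M)%N by apply: leq_trans XW; rewrite leq_pmulr.
(* Each monomial bound is multiplied by its symbolic coefficient in advance, so that the goal is
   linear in the remaining products for [lia]. *)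
have := leq_mul (leqnn n) XW; have := leq_mul (leqnn cX) XWE.
have := leq_mul (leqnn cI) XL; have := leq_mul (leqnn cL) X1.
have := leq_mul (leqnn (m * (2 * n))) X1.
have := leq_mul (leqnn cF) X1; have := leq_mul (leqnn cC) X1.
move: X1 XW XWE XL; clearbody M; lia.
Qed.

(** The termination test adds three operations per point of X^d and one comparison. As X^d is
    nonempty, [1 <= X <= M], so this is at most [4 * M] and 11 becomes 15. *)
Lemma iteration_cost_le (s : {ffun Xd P -> \bar R} * {ffun Xd P -> \bar R}) :
  ((iteration A Cidd s).2 <=
   (n + cX + 4 * cL + 2 * cI + m * (2 * n) + cF + cC + 15)
     * (X * W * E * lg (X + U)))%N.
Proof.
have W0 := Wd_card_gt0.
have X0 : (0 < X)%N by rewrite cardfs_gt0 (Xd_neq0 hP).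
have XM : (X <= X * W * E * lg (X + U))%N.
  by rewrite -!mulnA leq_pmulr // !muln_gt0 W0 E_gt0.
set M := (X * W * E * _)%N in XM *.
apply: (@leq_trans (X * 3 + (1 + (n + cX + 4 * cL + 2 * cI + m * (2 * n) +
  cF + cC + 11) * M))%N); last by lia.
apply: leq_add; first exact: leq_sum_fset.
apply: leq_add => //; case: ifP => _ //.
by rewrite [leqLHS]addn0; apply: iteration_body_cost_le.
Qed.

End Costs.

Theorem theorem3p12 (R : realType) (n m : nat) (A : routines R)
    (hllt : llt_linear A) (hlerp : lerp_logarithmic A)
    (I : Type) (P : I -> problem R n m) (hP : forall i, standing (P i))
    (hanalytic : exists c : nat, forall i,
       (forall x, (fs_cost (P i) x <= c)%N) /\
       (forall x, Xset (P i) x -> (Cs_cost (P i) x <= c)%N) /\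
       (forall u, Uset (P i) u -> (Ci_cost (P i) u <= c)%N))
    (hgrids : isBigO (fun i => (Yg_cost (P i) + Vg_cost (P i) + Zg_cost (P i))%N)
                   (fun i => (#|` Xd (P i)| + #|` Ud (P i)|)%N))
    (hYdim : forall i j, #|` coords j (Yg (P i))| = #|` coords j (Xd (P i))|)
    (hZdim : forall i j, #|` coords j (Zg (P i))| = #|` coords j (Xd (P i))|)
    (hVdim : forall i j, #|` coords j (Vg (P i))| = #|` coords j (Ud (P i))|)
    (hY : forall i, #|` Yg (P i)| = #|` Xd (P i)|)
    (hZ : forall i, #|` Zg (P i)| = #|` Xd (P i)|)
    (hV : forall i, #|` Vg (P i)| = #|` Ud (P i)|)
    (E : I -> nat) (hE : forall i, (0 < E i)%N)
    (hext : exists c : nat, forall i J x, (ext_cost (P i) J x <= c * E i)%N) :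
  isBigO (fun i => initialization_cost A (P i))
       (fun i => (#|` Xd (P i)| + #|` Ud (P i)|)%N) /\
  isSoftO (fun it : I * nat => (#|` Xd (P it.1)| + #|` Ud (P it.1)|)%N)
        (fun it => iteration_cost A (P it.1) it.2)
        (fun it => (#|` Xd (P it.1)| * #|` Wd (P it.1)| * E it.1)%N).
Proof.
have [cC analytic_le] := hanalytic; have [cG grids_le] := hgrids.
have [cX ext_le] := hext.
have [cLn lltn_le] := hllt n; have [cLm lltm_le] := hllt m.
have [cIn lerpn_le] := hlerp n; have [cIm lerpm_le] := hlerp m.
split.
  exists (cC + cG + 2 * cLm + 3)%N => i; have [_ [Cs_le Ci_le]] := analytic_le i.
  by apply: initialization_cost_le => // h; apply/lltm_le/Vg_grid.
(* The sum [cIn + cIm] serves the interpolations in both dimensions, and [cC] bounds both f_s and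
   C_s. The logarithm enters to the first power. *)
exists (n + cX + 4 * cLn + 2 * (cIn + cIm) + m * (2 * n) + cC + cC + 15)%N, 1%N.
move=> [i t] /=; have [fs_le [Cs_le _]] := analytic_le i.
(* The bound holds for arbitrary tables, so the actual ones are forgotten; an iteration that is not
   reached costs 0. *)
rewrite /iteration_cost; case: (initialization _ _).1 => _ Cidd.
case: (trace _ _ _) => [s|//]; rewrite expn1.
apply: iteration_cost_le => //.
- by move=> v; apply: leq_trans (lerpm_le _ _ _ (Vg_grid (hP i))) _;
    rewrite leq_mul2r leq_addl orbT.
- by move=> h z; apply: leq_trans (lerpn_le _ _ _ (Zg_grid (hP i))) _;
    rewrite leq_mul2r leq_addr orbT.
Qed.
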